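(* Let $\alpha\in(1,\infty)$, $\epsilon\ge0$ and $\delta\in(0,1]$, and let $\mathbb{D}_\alpha$ be (a member of) a family of quantum Rényi relative entropies. If a quantum channel $\mathcal{A}$ is $(\epsilon,\alpha)$-Rényi differentially private, then it is $$\Big(\epsilon+\frac{g(\delta)}{\alpha-1},\ \delta\Big)\text{-differentially private},\qquad g(\delta)=-\log\big(1-\sqrt{1-\delta^2}\big).$$
   Context: Hilbert spaces are finite-dimensional; a quantum channel is a completely positive trace-preserving map; $\log$ is the natural logarithm. Fix a set of quantum states $\mathcal{D}$ with a neighbouring relation $\sim$. $\mathcal{A}$ is $(\epsilon,\delta)$-differentially private if for all operators $0\le M\le I$ and all $\rho,\sigma\in\mathcal{D}$ with $\rho\sim\sigma$, $\operatorname{Tr}(M\mathcal{A}(\rho))\le e^\epsilon\operatorname{Tr}(M\mathcal{A}(\sigma))+\delta$. $\mathcal{A}$ is $(\epsilon,\alpha)$-Rényi differentially private if $\sup_{\rho\sim\sigma}\mathbb{D}_\alpha(\mathcal{A}(\rho)\|\mathcal{A}(\sigma))\le\epsilon$. A quantum Rényi relative entropy (divergence) is a quantity $\mathbb{D}(\rho\|\sigma)$ of positive semidefinite operators with the following properties. (1) Continuity: continuous in $\rho,\sigma$ wherever $\rho\ne0$ and the support of $\rho$ is contained in that of $\sigma$. (2) Unitary invariance: $\mathbb{D}(\rho\|\sigma)=\mathbb{D}(U\rho U^\dagger\|U\sigma U^\dagger)$ for unitary $U$. (3) Normalization: $\mathbb{D}(1\|\frac12)=\log2$. (4) Order: $\rho\ge\sigma$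 implies $\mathbb{D}(\rho\|\sigma)\ge0$, and $\rho\le\sigma$ implies $\mathbb{D}(\rho\|\sigma)\le0$. (5) Additivity: $\mathbb{D}(\rho\otimes\tau\|\sigma\otimes\omega)=\mathbb{D}(\rho\|\sigma)+\mathbb{D}(\tau\|\omega)$. (6) General mean: there is a continuous strictly monotonic function $g_0$ such that $Q=g_0(\mathbb{D})$ satisfies $Q(\rho\oplus\tau\|\sigma\oplus\omega)=\frac{\operatorname{Tr}\rho}{\operatorname{Tr}(\rho+\tau)}Q(\rho\|\sigma)+\frac{\operatorname{Tr}\tau}{\operatorname{Tr}(\rho+\tau)}Q(\tau\|\omega)$. (7) Positive definiteness: on states, $\mathbb{D}(\rho\|\sigma)\ge0$ with equality iff $\rho=\sigma$. (8) Data-processing: $\mathbb{D}(\rho\|\sigma)\ge\mathbb{D}(\mathcal{N}(\rho)\|\mathcal{N}(\sigma))$ for every quantum channel $\mathcal{N}$. (9) $Q$ is jointly convex or jointly concave. (10) Dominance: $\sigma\le\sigma'$ implies $\mathbb{D}(\rho\|\sigma)\ge\mathbb{D}(\rho\|\sigma')$. A family of quantum Rényi relative entropies is a one-parameter family $\alpha\mapsto\mathbb{D}_\alpha$ of such quantities, monotonically increasing in $\alpha$ on some open interval containing $1$. The index $\alpha$ is the usual one: on commuting (classical) states with probability distributions $p,q$, $\mathbb{D}_\alpha$ equals the classical Rényi relative entropy $\frac1{\alpha-1}\log\sum_xp(x)^\alpha q(x)^{1-\alpha}$. For $\alpha>1$, $\mathbb{D}_\alpha(\rho\|\sigma)=+\infty$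 if the support of $\rho$ is not contained in that of $\sigma$. *)

(* Defs.v *)
From mathcomp Require Import all_boot all_order all_algebra.
From mathcomp Require Import complex mxtens.
From mathcomp Require Import all_classical all_reals all_analysis.

Set Implicit Arguments.
Unset Strict Implicit.
Unset Printing Implicit Defensive.

Import Order.TTheory GRing.Theory Num.Theory.
Import numFieldTopology.Exports numFieldNormedType.Exports.

Local Open Scope classical_set_scope.
Local Open Scope ring_scope.
Local Open Scope complex_scope.
Local Open Scope sesquilinear_scope.

(* An operator on the Hilbert space C^n is a matrix over C = R[i], acting on
   row vectors from the right, as in mathcomp's matrix libraries; its range is
   thus its row space. *)

Definition psdmx (R : realType) (n : nat) (X : 'M[R[i]]_n) : Prop :=
  forall v : 'rV[R[i]]_n, 0 <= (v *m X *m v^t*) 0 0.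

Definition loewner_le (R : realType) (n : nat) (X Y : 'M[R[i]]_n) : Prop :=
  psdmx (Y - X).

Definition quantum_state (R : realType) (n : nat) (rho : 'M[R[i]]_n) : Prop :=
  psdmx rho /\ \tr rho = 1.

(* The trace of a positive semidefinite operator is real: nothing is lost. *)
Definition rtrace (R : realType) (n : nat) (X : 'M[R[i]]_n) : R :=
  complex.Re (\tr X).

Definition dsummx (R : realType) (n m : nat)
    (X : 'M[R[i]]_n) (Y : 'M[R[i]]_m) : 'M[R[i]]_(n + m) :=
  block_mx X 0 0 Y.

(* The (i, j) block of an operator on C^k (x) C^n. *)
Definition tensblock (R : realType) (k n : nat) (X : 'M[R[i]]_(k * n))
    (i j : 'I_k) : 'M[R[i]]_n :=
  \matrix_(a, b) X (mxtens_index (i, a)) (mxtens_index (j, b)).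

(* id_k (x) N, computed on X = \sum_(i, j) E_ij (x) X_ij. *)
Definition ampliation (R : realType) (k n m : nat)
    (N : 'M[R[i]]_n -> 'M[R[i]]_m) (X : 'M[R[i]]_(k * n)) :
    'M[R[i]]_(k * m) :=
  \sum_(i < k) \sum_(j < k) (delta_mx i j *t N (tensblock X i j)).

Definition completely_positive (R : realType) (n m : nat)
    (N : 'M[R[i]]_n -> 'M[R[i]]_m) : Prop :=
  forall (k : nat) (X : 'M[R[i]]_(k * n)), psdmx X -> psdmx (ampliation N X).

Definition trace_preserving (R : realType) (n m : nat)
    (N : 'M[R[i]]_n -> 'M[R[i]]_m) : Prop :=
  forall X : 'M[R[i]]_n, \tr (N X) = \tr X.

Definition quantum_channel (R : realType) (n m : nat)
    (N : {linear 'M[R[i]]_n -> 'M[R[i]]_m}) : Prop :=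
  completely_positive N /\ trace_preserving N.

(* Values of a divergence are only ever constrained on positive semidefinite
   operators with a nonzero first argument. *)
Definition divergence (R : realType) : Type :=
  forall n : nat, 'M[R[i]]_n -> 'M[R[i]]_n -> \bar R.

(* The cast to numFieldType gives the matrices their usual topology. *)
Definition oppair (R : realType) (n : nat) : topologicalType :=
  ('M[(R[i] : numFieldType)]_n * 'M[(R[i] : numFieldType)]_n)%type.

(* The pairs (rho, sigma) with rho nonzero and supp rho contained in supp sigma,
   for sigma whose support is the row space of W.  Continuity is required below
   on each of these sets, that is, as long as the support of sigma does not
   change, and not on their union over W: no divergence that extends the classical one is
   continuous on the union.  E.g. for alpha = 2, p = (1 - s, s) and
   q = (1 - s^2, s^2), D(p||q) tends to log 2 as s -> 0, whereas p and q both
   tend to (1, 0), and D((1, 0)||(1, 0)) = 0. *)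
Definition supported_pairs (R : realType) (n : nat) (W : 'M[R[i]]_n) :
    set (oppair R n) :=
  [set rs | [/\ psdmx rs.1, psdmx rs.2, rs.1 != 0, (rs.1 <= rs.2)%MS &
                (rs.2 == W)%MS]].

(* Q is a function on extended reals: a continuous strictly monotonic g0 on the
   reals has a unique continuous strictly monotonic extension to \bar R, and
   conversely a strictly monotonic g0 on \bar R is finite on the reals. *)
Definition strictly_monotonic (R : realType) (g0 : \bar R -> \bar R) : Prop :=
  (forall x y, (x < y)%E -> (g0 x < g0 y)%E) \/
  (forall x y, (x < y)%E -> (g0 y < g0 x)%E).

Definition general_mean (R : realType) (Q : divergence R) : Prop :=
  forall (n m : nat) (rho sigma : 'M[R[i]]_n) (tau omega : 'M[R[i]]_m),
    psdmx rho -> psdmx sigma -> psdmx tau -> psdmx omega ->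
    rho != 0 -> tau != 0 ->
    Q (n + m)%N (dsummx rho tau) (dsummx sigma omega) =
    ((rtrace rho / (rtrace rho + rtrace tau))%:E * Q n rho sigma +
     (rtrace tau / (rtrace rho + rtrace tau))%:E * Q m tau omega)%E.

Definition mix (R : realType) (n : nat) (t : R) (X Y : 'M[R[i]]_n) :
    'M[R[i]]_n := t%:C *: X + (1 - t)%:C *: Y.

(* Joint convexity and concavity are meant on normalized states: on unnormalized
   operators both already fail for positive scalars, where Q is
   (x / y)^(alpha - 1), or log (x / y) for alpha = 1. *)
Definition jointly_convex (R : realType) (Q : divergence R) : Prop :=
  forall (n : nat) (rho1 rho2 sigma1 sigma2 : 'M[R[i]]_n) (t : R),
    quantum_state rho1 -> quantum_state rho2 ->
    quantum_state sigma1 -> quantum_state sigma2 -> 0 <= t <= 1 ->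
    (Q n (mix t rho1 rho2) (mix t sigma1 sigma2) <=
     t%:E * Q n rho1 sigma1 + (1 - t)%:E * Q n rho2 sigma2)%E.

Definition jointly_concave (R : realType) (Q : divergence R) : Prop :=
  forall (n : nat) (rho1 rho2 sigma1 sigma2 : 'M[R[i]]_n) (t : R),
    quantum_state rho1 -> quantum_state rho2 ->
    quantum_state sigma1 -> quantum_state sigma2 -> 0 <= t <= 1 ->
    (t%:E * Q n rho1 sigma1 + (1 - t)%:E * Q n rho2 sigma2 <=
     Q n (mix t rho1 rho2) (mix t sigma1 sigma2))%E.

Record quantum_renyi_divergence (R : realType) (D : divergence R) : Prop :=
  QuantumRenyiDivergence {
  qrd_continuity : forall (n : nat) (W : 'M[R[i]]_n),
    {within supported_pairs W,
      continuous (fun rs : oppair R n => D n rs.1 rs.2)};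
  qrd_unitary : forall (n : nat) (rho sigma U : 'M[R[i]]_n),
    psdmx rho -> psdmx sigma -> rho != 0 -> U \is unitarymx ->
    D n rho sigma = D n (U *m rho *m U^t*) (U *m sigma *m U^t*);
  qrd_normalization : D 1%N 1%:M (2^-1)%:M = (ln 2)%:E;
  qrd_order_ge : forall (n : nat) (rho sigma : 'M[R[i]]_n),
    psdmx rho -> psdmx sigma -> rho != 0 -> loewner_le sigma rho ->
    (0 <= D n rho sigma)%E;
  qrd_order_le : forall (n : nat) (rho sigma : 'M[R[i]]_n),
    psdmx rho -> psdmx sigma -> rho != 0 -> loewner_le rho sigma ->
    (D n rho sigma <= 0)%E;
  qrd_additivity :
    forall (n m : nat) (rho sigma : 'M[R[i]]_n) (tau omega : 'M[R[i]]_m),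
    psdmx rho -> psdmx sigma -> psdmx tau -> psdmx omega ->
    rho != 0 -> tau != 0 ->
    D (n * m)%N (rho *t tau) (sigma *t omega) =
    (D n rho sigma + D m tau omega)%E;
  qrd_mean : exists g0 : \bar R -> \bar R,
    let Q : divergence R := fun n rho sigma => g0 (D n rho sigma) in
    [/\ continuous g0, strictly_monotonic g0, general_mean Q &
        jointly_convex Q \/ jointly_concave Q];
  qrd_ge0 : forall (n : nat) (rho sigma : 'M[R[i]]_n),
    quantum_state rho -> quantum_state sigma -> (0 <= D n rho sigma)%E;
  qrd_eq0 : forall (n : nat) (rho sigma : 'M[R[i]]_n),
    quantum_state rho -> quantum_state sigma ->
    (D n rho sigma = 0%E <-> rho = sigma);
  qrd_data_processing : forall (n m : nat)
      (N : {linear 'M[R[i]]_n -> 'M[R[i]]_m}) (rho sigma : 'M[R[i]]_n),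
    psdmx rho -> psdmx sigma -> rho != 0 -> quantum_channel N ->
    (D m (N rho) (N sigma) <= D n rho sigma)%E;
  qrd_dominance : forall (n : nat) (rho sigma sigma' : 'M[R[i]]_n),
    psdmx rho -> psdmx sigma -> psdmx sigma' -> rho != 0 ->
    loewner_le sigma sigma' -> (D n rho sigma' <= D n rho sigma)%E
}.

Definition prob_vector (R : realType) (n : nat) (p : 'rV[R]_n) : Prop :=
  (forall x, 0 <= p 0 x) /\ \sum_x p 0 x = 1.

(* Meant for alpha > 0, alpha <> 1.  A term p(x)^alpha q(x)^(1 - alpha) with
   alpha > 1, p(x) > 0 and q(x) = 0 is infinite, but powR would give 0: hence
   the case distinction.  For alpha < 1 and disjoint supports, lne 0 = -oo
   yields the value +oo. *)
Definition classical_renyi (R : realType) (alpha : R) (n : nat)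
    (p q : 'rV[R]_n) : \bar R :=
  if (1 < alpha) && [exists x, (p 0 x != 0) && (q 0 x == 0)] then +oo%E
  else (((alpha - 1)^-1)%:E *
        lne (\sum_x p 0 x `^ alpha * q 0 x `^ (1 - alpha))%:E)%E.

(* The state with eigenvalues p in the eigenbasis given by U: two states commute
   iff they have this form for the same U. *)
Definition classical_state (R : realType) (n : nat) (U : 'M[R[i]]_n)
    (p : 'rV[R]_n) : 'M[R[i]]_n :=
  U *m diag_mx (map_mx (real_complex R) p) *m U^t*.

(* [I] is the set of indices for which the family is defined, e.g. (0, 2] for
   the Petz divergences or [1/2, +oo) for the sandwiched ones. *)
Record renyi_family (R : realType) (I : set R) (D : R -> divergence R) : Prop :=
  RenyiFamily {
  rf_divergence : forall alpha, I alpha -> quantum_renyi_divergence (D alpha);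
  rf_monotone : exists a b : R,
    [/\ a < 1 < b, (forall alpha, a < alpha < b -> I alpha) &
        forall alpha beta, a < alpha -> alpha <= beta -> beta < b ->
        forall (n : nat) (rho sigma : 'M[R[i]]_n),
          psdmx rho -> psdmx sigma -> rho != 0 ->
          (D alpha n rho sigma <= D beta n rho sigma)%E];
  rf_classical : forall alpha, I alpha -> 0 < alpha -> alpha != 1 ->
    forall (n : nat) (U : 'M[R[i]]_n) (p q : 'rV[R]_n),
      U \is unitarymx -> prob_vector p -> prob_vector q ->
      D alpha n (classical_state U p) (classical_state U q) =
      classical_renyi alpha p q;
  rf_infinite : forall alpha, I alpha -> 1 < alpha ->
    forall (n : nat) (rho sigma : 'M[R[i]]_n),
      psdmx rho -> psdmx sigma -> ~~ (rho <= sigma)%MS ->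
      D alpha n rho sigma = +oo%E
}.

(* On R[i], x <= y means that the real parts are so ordered and the imaginary
   parts are equal; the traces below are real. *)
Definition differentially_private (R : realType) (n m : nat)
    (states : set 'M[R[i]]_n) (nbr : 'M[R[i]]_n -> 'M[R[i]]_n -> Prop)
    (A : 'M[R[i]]_n -> 'M[R[i]]_m) (eps delta : R) : Prop :=
  forall (M : 'M[R[i]]_m) (rho sigma : 'M[R[i]]_n),
    psdmx M -> loewner_le M 1%:M ->
    states rho -> states sigma -> nbr rho sigma ->
    \tr (M *m A rho) <= (expR eps)%:C * \tr (M *m A sigma) + delta%:C.

Definition renyi_differentially_private (R : realType) (n m : nat)
    (D : divergence R)
    (states : set 'M[R[i]]_n) (nbr : 'M[R[i]]_n -> 'M[R[i]]_n -> Prop)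
    (A : 'M[R[i]]_n -> 'M[R[i]]_m) (eps : R) : Prop :=
  (ereal_sup [set d | exists rho sigma, [/\ states rho, states sigma,
      nbr rho sigma & d = D m (A rho) (A sigma)]] <= eps%:E)%E.

Definition g_smooth (R : realType) (delta : R) : R :=
  - ln (1 - Num.sqrt (1 - delta ^+ 2)).

(* Main.v *)
(* The binary measurement {M, 1 - M} is a channel, so by data processing the
   outcome distributions p, q of A rho and A sigma satisfy
   p(x)^alpha q(x)^(1 - alpha) <= exp((alpha - 1) eps) for each outcome x.  If
   p(x) > delta, then p(x) p(x)^(1 / (alpha - 1)) <= exp(eps) q(x) gives
   p(x) <= exp(eps) (1 / delta)^(1 / (alpha - 1)) q(x), and
   log (1 / delta) <= g(delta).  Complete positivity of the measurement comes
   from factoring each effect as B^* B. *)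
Require Import Defs.
From HB Require Import structures.
From mathcomp Require Import all_boot all_order all_algebra.
From mathcomp Require Import complex mxtens.
From mathcomp Require Import all_classical all_reals all_analysis.
From mathcomp Require Import lra.

Set Implicit Arguments.
Unset Strict Implicit.
Unset Printing Implicit Defensive.

Import Order.TTheory GRing.Theory Num.Theory.

Local Open Scope classical_set_scope.
Local Open Scope ring_scope.
Local Open Scope complex_scope.
Local Open Scope sesquilinear_scope.

Section PositiveSemidefinite.
Context {R : realType}.
Implicit Types k n m : nat.
Local Notation C := R[i].

Lemma quad_formE n (X : 'M[C]_n) (v : 'rV[C]_n) :
  (v *m X *m v^t*) 0 0 =
  \sum_a \sum_b v 0 a * X a b * Num.conj (v 0 b).
Proof.
rewrite mxE exchange_big; apply: eq_bigr => b _.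
by rewrite !mxE mulr_suml.
Qed.

Lemma sum_mxtens k n (F : 'I_(k * n) -> C) :
  \sum_s F s = \sum_i \sum_a F (mxtens_index (i, a)).
Proof.
rewrite pair_big (reindex (@mxtens_index k n)) /=; last first.
  by exists (@mxtens_unindex k n) => s _;
    rewrite ?mxtens_indexK ?mxtens_unindexK.
by apply: eq_bigr => -[].
Qed.

Lemma quad_form_mxtensE k n (X : 'M[C]_(k * n)) (v : 'rV[C]_(k * n)) :
  (v *m X *m v^t*) 0 0 =
  \sum_i \sum_j \sum_a \sum_b v 0 (mxtens_index (i, a)) *
    X (mxtens_index (i, a)) (mxtens_index (j, b)) *
    Num.conj (v 0 (mxtens_index (j, b))).
Proof.
rewrite quad_formE sum_mxtens; apply: eq_bigr => i _.
rewrite [RHS]exchange_big; apply: eq_bigr => a _; exact: sum_mxtens.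
Qed.

(** Polarization: over the complex numbers [0 <= z] forces [z] to be real. The form at e_i + c e_j
    is therefore real: c = 0 makes the diagonal real, c = 1 gives opposite imaginary parts of the
    (i, j) and (j, i) entries, and c = 'i gives equal real parts. *)
Lemma psdmx_hermitian n (X : 'M[C]_n) : psdmx X -> X \is hermsymmx.
Proof.
move=> Xpsd.
have polar (c : C) i j :
    0 <= X i i + c * X j i + (X i j + c * X j j) * Num.conj c.
  have := Xpsd (delta_mx 0 i + c *: delta_mx 0 j).
  rewrite mulmxDl -scalemxAl -!rowE !mxE.
  rewrite (_ : \sum_k _ =
    X i i + c * X j i + (X i j + c * X j j) * Num.conj c) //.
  transitivity (((row i X + c *: row j X) *m
    (delta_mx i 0 + Num.conj c *: delta_mx j 0 : 'cV_n)) 0 0).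
    rewrite mxE. apply: eq_bigr => k _. congr (_ * _).
    by rewrite !mxE rmorphD rmorphM !rmorph_nat !eqxx !andbT.
  rewrite mulmxDr -scalemxAr -!colE !mxE.
  by rewrite (mulrC (Num.conj c)).
have diag i : complex.Im (X i i) = 0.
  have := polar 0 i i; rewrite !mul0r !addr0 rmorph0 mulr0 addr0.
  exact: ger0_Im.
apply/is_hermitianmxP; rewrite expr0 scale1r; apply/matrixP => i j.
rewrite !mxE.
have := ger0_Im (polar 1 i j); have := ger0_Im (polar 'i i j).
have := diag i; have := diag j.
case: (X i i) => ? ?; case: (X j j) => ? ?; case: (X i j) => ? ?.
case: (X j i) => ? ?; rewrite rmorph1 /= => -> ->.
move=> h1 h2; congr Complex; lra.
Qed.

(** By the spectral theorem X = P^* diag(d) P with P unitary, so B = diag(sqrt d) P works once d is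
    known to be nonnegative. *)
Lemma psdmx_factor n (X : 'M[C]_n) :
  psdmx X -> exists B : 'M[C]_n, X = B^t* *m B.
Proof.
move=> Xpsd.
have /hermitian_normalmx/orthomx_spectralP := psdmx_hermitian Xpsd.
set P := spectralmx X; set d := spectral_diag X => XE.
have Pu : P \is unitarymx := spectral_unitarymx X.
(* Row i of [P] is a unit eigenvector, and the form at it is the eigenvalue. *)
have d_ge0 i : 0 <= d 0 i.
  have := Xpsd (row i P).
  rewrite {1}XE invmx_unitary // rowE !mulmxA.
  rewrite mulmxtVK // -[_ *m P *m _]mulmxA.
  rewrite trmx_mul map_mxM !mulmxA mulmxtVK //.
  rewrite -rowE.
  rewrite mxE (bigD1 i) //= big1 => [|j /negPf ji]; last first.
    by rewrite !mxE ji eq_sym ji mulr0n mul0r.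
  by rewrite !mxE !eqxx mulr1n rmorph1 mulr1 addr0.
exists (diag_mx (map_mx sqrtC d) *m P).
rewrite {1}XE invmx_unitary // trmx_mul map_mxM !mulmxA.
congr (_ *m _); rewrite -mulmxA; congr (_ *m _).
rewrite tr_diag_mx map_diag_mx mulmx_diag; congr diag_mx; apply/rowP => i.
rewrite !mxE; transitivity (Num.conj (sqrtC (d 0 i)) * sqrtC (d 0 i)) => //.
by rewrite geC0_conj ?sqrtC_ge0 // -expr2 sqrtCK.
Qed.

Lemma ampliationE k n m (N : 'M[C]_n -> 'M[C]_m) (X : 'M[C]_(k * n)) i j c d :
  ampliation N X (mxtens_index (i, c)) (mxtens_index (j, d)) =
  N (tensblock X i j) c d.
Proof.
rewrite summxE (bigD1 i) //= summxE (bigD1 j) //= tensmxE mxE !eqxx mul1r.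
rewrite big1 => [|j' /negPf jj]; last first.
  by rewrite tensmxE mxE eqxx eq_sym jj mul0r.
rewrite big1 ?addr0 // => i' /negPf ii; rewrite summxE big1 // => j' _.
by rewrite tensmxE mxE eq_sym ii mul0r.
Qed.

(** The case k = 1 of complete positivity. The dimensions [1 * n] and [n] are not convertible, so X
    enters as [1%:M *t X] and vectors are reindexed. *)
Lemma completely_positive_psdmx n m (N : 'M[C]_n -> 'M[C]_m) (X : 'M[C]_n) :
  completely_positive N -> psdmx X -> psdmx (N X).
Proof.
move=> Ncp Xpsd.
have blockE : tensblock (1%:M *t X : 'M[C]_(1 * n)) 0 0 = X.
  by apply/matrixP => a b; rewrite mxE tensmxE mxE mul1r.
have X1psd : psdmx (1%:M *t X : 'M[C]_(1 * n)).
  move=> v; rewrite quad_form_mxtensE !big_ord1.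
  have := Xpsd (\row_a v 0 (mxtens_index (0, a))); rewrite quad_formE.
  congr (_ <= _); apply: eq_bigr => a _.
  by apply: eq_bigr => b _; rewrite tensmxE !mxE mul1r.
move=> v; have := Ncp 1 _ X1psd (\row_s v 0 (mxtens_unindex s).2).
rewrite quad_form_mxtensE quad_formE !big_ord1; congr (_ <= _).
apply: eq_bigr => a _.
by apply: eq_bigr => b _; rewrite ampliationE blockE !mxE !mxtens_indexK.
Qed.

(** By cyclicity this is the trace of B X B^*, a sum of values of the form of X at the rows of B. *)
Lemma mxtrace_factorE n m (B : 'M[C]_(m, n)) (X : 'M[C]_n) :
  \tr (B^t* *m B *m X) =
  \sum_l \sum_a \sum_b B l a * X a b * Num.conj (B l b).
Proof.
rewrite -mulmxA mxtrace_mulC; apply: eq_bigr => l _.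
rewrite mxE exchange_big; apply: eq_bigr => b _.
by rewrite !mxE mulr_suml.
Qed.

Lemma mxtrace_psdmx_mul_ge0 n (X Y : 'M[C]_n) :
  psdmx X -> psdmx Y -> 0 <= \tr (X *m Y).
Proof.
move=> /psdmx_factor[B ->] Ypsd; rewrite mxtrace_factorE.
apply: sumr_ge0 => l _; have := Ypsd (row l B); rewrite quad_formE.
by congr (_ <= _); apply: eq_bigr => a _; apply: eq_bigr => b _; rewrite !mxE.
Qed.

End PositiveSemidefinite.

Section Measurement.
Context {R : realType} {k n : nat}.
Variable E : 'I_k -> 'M[R[i]]_n.

(** The quantum-to-classical channel of the effects [E]: outcome weights sit on the diagonal, so all
    outputs commute. *)
Definition measurement (X : 'M[R[i]]_n) : 'M[R[i]]_k :=
  diag_mx (\row_c \tr (E c *m X)).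

Fact measurement_is_linear : linear measurement.
Proof.
move=> a X Y; apply/matrixP => i j.
by rewrite !mxE mulmxDr -scalemxAr mxtraceD mxtraceZ mulrnDl mulrnAr.
Qed.

HB.instance Definition _ :=
  GRing.isLinear.Build R[i] 'M[R[i]]_n 'M[R[i]]_k _ measurement
    measurement_is_linear.

Lemma measurement_channel :
  (forall c, psdmx (E c)) -> \sum_c E c = 1%:M -> quantum_channel measurement.
Proof.
move=> Epsd E1; split=> [h X Xpsd v|X]; last first.
  rewrite mxtrace_diag -[in RHS](mul1mx X) -E1 mulmx_suml raddf_sum.
  by apply: eq_bigr => c _; rewrite mxE.
(* Outputs are diagonal, so only pairs of equal outcomes contribute. *)
have -> : (v *m ampliation measurement X *m v^t*) 0 0
    = \sum_c \sum_i \sum_j v 0 (mxtens_index (i, c)) *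
        \tr (E c *m tensblock X i j) * Num.conj (v 0 (mxtens_index (j, c))).
  rewrite quad_form_mxtensE [RHS]exchange_big; apply: eq_bigr => i _.
  rewrite [RHS]exchange_big; apply: eq_bigr => j _; apply: eq_bigr => c _.
  rewrite (bigD1 c) //= big1 => [|d /negPf dc]; rewrite ampliationE !mxE.
    by rewrite eqxx mulr1n addr0.
  by rewrite eq_sym dc mulr0 mul0r.
apply: sumr_ge0 => c _; have [B ->] := psdmx_factor (Epsd c).
under eq_bigr do under eq_bigr do rewrite mxtrace_factorE mulr_sumr mulr_suml.
under eq_bigr do rewrite exchange_big.
rewrite exchange_big; apply: sumr_ge0 => l _.
(* For fixed c and l the summand is the form of X at the tensor product of v(., c) with row l of
   B. *)
have := Xpsd (\row_s (v 0 (mxtens_index ((mxtens_unindex s).1, c)) *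
                      B l (mxtens_unindex s).2)).
rewrite quad_form_mxtensE; congr (_ <= _).
apply: eq_bigr => i _; apply: eq_bigr => j _.
rewrite mulr_sumr mulr_suml; apply: eq_bigr => a _.
rewrite mulr_sumr mulr_suml; apply: eq_bigr => b _.
by rewrite !mxE !mxtens_indexK /= rmorphM !mulrA mulrAC.
Qed.

End Measurement.

(** It suffices that 1 - delta <= sqrt (1 - delta^2), which follows from (1 - delta)^2 <= 1 -
    delta^2 on [0, 1]. *)
Lemma g_smooth_ge (R : realType) (delta : R) :
  0 < delta <= 1 -> - ln delta <= g_smooth delta.
Proof.
move=> /andP[d0 d1]; rewrite lerN2 ler_ln ?posrE //; last first.
  rewrite subr_gt0 -[ltRHS]sqrtr1 ltr_sqrt // ltrBlDr ltrDl.
  exact: exprn_gt0.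
rewrite lerBlDr -lerBlDl -[leLHS]ger0_norm ?subr_ge0 // -sqrtr_sqr.
apply: ler_wsqrtr; rewrite !expr2; nra.
Qed.

Lemma classical_renyi_dp (R : realType) (n : nat) (p q : 'rV[R]_n)
    (alpha eps delta : R) (x : 'I_n) :
  1 < alpha -> 0 < delta <= 1 -> 0 <= q 0 x ->
  (classical_renyi alpha p q <= eps%:E)%E ->
  p 0 x <= expR (eps + g_smooth delta / (alpha - 1)) * q 0 x + delta.
Proof.
move=> alpha1 delta01 q0; rewrite /classical_renyi alpha1 andTb.
(* A finite bound excludes the infinite case, so q(x) = 0 forces p(x) = 0. *)
case: ifPn => [_ //|/existsPn/(_ x)]; rewrite negb_and !negbK => supp.
have [pd _|pd] := leP (p 0 x) delta.
  by rewrite (le_trans pd) // lerDr mulr_ge0 // expR_ge0.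
have d0 : 0 < delta by case/andP: delta01.
have p0 : 0 < p 0 x by exact: lt_trans pd.
have {supp q0}q0 : 0 < q 0 x.
  by rewrite lt_neqAle q0 andbT eq_sym; move: supp; rewrite gt_eqF.
set S := \sum_x _; set t := p 0 x `^ alpha * q 0 x `^ (1 - alpha).
have t0 : 0 < t by rewrite mulr_gt0 // powR_gt0.
(* All terms are nonnegative, so the sum bounds the single term at x. *)
have tS : t <= S.
  rewrite /S (bigD1 x) //= lerDl sumr_ge0 // => y _.
  by rewrite mulr_ge0 // powR_ge0.
have S0 : 0 < S := lt_le_trans t0 tS.
rewrite lne_EFin // -EFinM lee_fin ler_pdivrMl ?subr_gt0 // => lnS.
have lnt : alpha * ln (p 0 x) + (1 - alpha) * ln (q 0 x) <= (alpha - 1) * eps.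
  by rewrite -!ln_powR -lnM ?posrE ?powR_gt0 // (le_trans _ lnS) // ler_ln.
have lnd : ln delta <= ln (p 0 x) by rewrite ler_ln ?posrE // ltW.
have gd := g_smooth_ge delta01.
apply: (@le_trans _ _ (expR (eps + g_smooth delta / (alpha - 1)) * q 0 x));
  last by rewrite lerDl ltW.
(* After taking logarithms and multiplying by alpha - 1, the goal is linear in [lnt], [lnd] and
   [gd]. *)
rewrite -[leLHS](lnK p0) -[X in _ * X](lnK q0) -expRD ler_expR.
rewrite -(@ler_pM2l _ (alpha - 1)) ?subr_gt0 //.
rewrite 2!mulrDr mulrCA mulfV ?mulr1; last by rewrite subr_eq0 gt_eqF.
lra.
Qed.

Theorem lemmaV5 (R : realType) (n m : nat)
    (states : set 'M[R[i]]_n) (nbr : 'M[R[i]]_n -> 'M[R[i]]_n -> Prop)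
    (A : {linear 'M[R[i]]_n -> 'M[R[i]]_m})
    (I : set R) (D : R -> divergence R) (alpha eps delta : R)
    (hstates : forall rho, states rho -> quantum_state rho)
    (hA : quantum_channel A)
    (hD : renyi_family I D) (hI : I alpha)
    (halpha : 1 < alpha) (heps : 0 <= eps) (hdelta : 0 < delta <= 1)
    (hRDP : renyi_differentially_private (D alpha) states nbr A eps) :
  differentially_private states nbr A
    (eps + g_smooth delta / (alpha - 1)) delta.
Proof.
move=> M rho sigma Mpsd M1 rhoS sigmaS rhosigma.
have {hA}[Acp Atp] := hA.
have A_state tau : states tau -> quantum_state (A tau).
  move=> /hstates[tau0 tau1]; split; first exact: completely_positive_psdmx.
  by rewrite Atp.
have [[rho0 rho1] [sigma0 sigma1]] := (A_state _ rhoS, A_state _ sigmaS).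
pose E (c : 'I_2) := if c == 0 then M else 1%:M - M.
have Epsd c : psdmx (E c) by rewrite /E; case: ifP.
have E1 : \sum_c E c = 1%:M by rewrite big_ord_recl big_ord1 /E /= addrC subrK.
(* For positive semidefinite X these traces are nonnegative reals, so taking real parts loses
   nothing. *)
pose outcomes (X : 'M[R[i]]_m) : 'rV[R]_2 := \row_c complex.Re (\tr (E c *m X)).
have outcomesE X c : psdmx X -> (outcomes X 0 c)%:C = \tr (E c *m X).
  by move=> Xpsd; rewrite mxE RRe_real // ger0_real // mxtrace_psdmx_mul_ge0.
have outcomes_ge0 X c : psdmx X -> 0 <= outcomes X 0 c.
  by move=> Xpsd; rewrite -ler0c outcomesE // mxtrace_psdmx_mul_ge0.
have outcomes_prob X : quantum_state X -> prob_vector (outcomes X).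
  move=> [Xpsd X1]; split=> [c|]; first exact: outcomes_ge0.
  apply: complexI; rewrite raddf_sum rmorph1 -X1 -[in RHS](mul1mx X) -E1.
  rewrite mulmx_suml raddf_sum; apply: eq_bigr => c _; exact: outcomesE.
have measurementE X : psdmx X ->
    measurement E X = classical_state 1%:M (outcomes X).
  move=> Xpsd; rewrite /classical_state trmx1 map_mx1 mul1mx mulmx1.
  by congr diag_mx; apply/rowP => c; rewrite !mxE -outcomesE // mxE.
have hDP : (classical_renyi alpha (outcomes (A rho)) (outcomes (A sigma)) <=
    eps%:E)%E.
  have [hdiv _ hcl _] := hD.
  (* Measured states are diagonal in the standard basis, hence U = 1; the classical divergence
     becomes that of the measured states. *)
  rewrite -(hcl _ hI (lt_trans ltr01 halpha) _ _ 1%:M) ?gt_eqF //; first last.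
  - exact: outcomes_prob.
  - exact: outcomes_prob.
  - by apply/unitarymxP; rewrite trmx1 map_mx1 mulmx1.
  rewrite -!measurementE //; apply: le_trans hRDP.
  apply: (@le_trans _ _ (D alpha m (A rho) (A sigma))).
    apply: (qrd_data_processing (hdiv _ hI)) => //.
      by apply: contra_eq_neq rho1 => ->; rewrite mxtrace0 eq_sym oner_eq0.
    exact: measurement_channel.
  by apply: ereal_sup_ubound; exists rho, sigma.
(* Outcome 0 has effect [M], so the bound at x = 0 is the claim, up to embedding the reals in the
   complex numbers. *)
have := classical_renyi_dp halpha hdelta (outcomes_ge0 _ 0 sigma0) hDP.
by rewrite -lecR rmorphD rmorphM /= !outcomesE.
Qed.
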